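(* Let $r\in\mathbb{N}$ (so $n=r\ge 1$), let $0<\alpha\le 1$ and let $0<\bar c<\bar c^{\ast}$. Then the capacity-achieving input distribution is $$p_X^{\ast}=\sum_{j=1}^{n+1} m_j\,\delta_{x_j},\qquad x_j=\frac{j-1}{n},\qquad m_j=\frac{e^{-\lambda^{\ast}c_j}}{z},\quad z=\sum_{j=1}^{n+1}e^{-\lambda^{\ast}c_j},\quad c_j=x_j^{\alpha},$$ for some $\lambda^{\ast}>0$ (namely the $\lambda^\ast$ for which $\sum_j m_j c_j=\bar c$). In particular $p_X^{\ast}$ is discrete with support $S_0=\{x_1,\dots,x_{n+1}\}$.
   Context: Fix $b>0$ and set $r:=1/(2b)$, $n:=\lfloor r\rfloor$. Consider the additive uniform noise channel $Y=X+N$ with $N\sim\mathrm{Uniform}(-b,b)$ independent of $X$, so the transition density is $p_N(y\mid x)=r\,\mathbf{1}_{x-b<y<x+b}$. Admissible inputs are probability distributions $p_X$ on $[0,1]$ (peak amplitude constraint). For such $p_X$ the output density is $p_Y(y;p_X)=\int p_N(y\mid x)\,dp_X(x)$, the marginal information density is $i(x;p_X)=\int p_N(y\mid x)\log\frac{p_N(y\mid x)}{p_Y(y;p_X)}\,dy\in[0,\infty]$, and $I(p_X)=\int i(x;p_X)\,dp_X(x)$ is the mutual information between $X$ and $Y$. The cost function is $c(x)=x^{\alpha}$ with $\alpha>0$. For $\bar c>0$, the capacity-achieving input distribution $p_X^{\ast}$ is the (unique) maximizer of $I(p_X)$ over probability distributions $p_X$ on $[0,1]$ with $\mathbb{E}_{p_X}[c(X)]\le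 \bar c$. Standard points and masses: let $N_r=n+1$ if $r\in\mathbb{N}$ and $N_r=2n+2$ if $r\notin\mathbb{N}$. For $j=1,\dots,N_r$ set $x_j=(j-1)/n$ if $r\in\mathbb{N}$; if $r\notin\mathbb{N}$, set $x_j=(j-1)/(2r)$ for odd $j$ and $x_j=1-(2n+2-j)/(2r)$ for even $j$. Let $S_0=\{x_1,\dots,x_{N_r}\}$. Define the unconstrained masses $m^0_j=1/(n+1)$ if $r\in\mathbb{N}$; if $r\notin\mathbb{N}$, $m^0_j=\frac{2n+2-(j-1)}{2(n+1)(n+2)}$ for odd $j$ and $m^0_j=\frac{j}{2(n+1)(n+2)}$ for even $j$. The distribution $\sum_j m^0_j\delta_{x_j}$ is the capacity-achieving input distribution without cost constraint, and the critical cost is $\bar c^{\ast}:=\sum_{j=1}^{N_r} m^0_j\,x_j^{\alpha}$ (the cost constraint is active iff $\bar c<\bar c^\ast$). *)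

(* Defs.v *)
From mathcomp Require Import all_boot all_algebra all_classical all_reals all_analysis.
Import GRing.Theory Num.Theory.
Local Open Scope ring_scope.
Local Open Scope classical_set_scope.

Section UniformNoiseChannel.
Context {R : realType}.

(* r = 1/(2b): height of the uniform noise density on (-b,b) *)
Definition noise_r (b : R) : R := 1 / (2 * b).

(* Output density p_Y(y;P) = \int r 1_{x-b<y<x+b} dP(x) = r * P((y-b,y+b)) *)
Definition out_dens (b : R) (P : probability R R) (y : R) : R :=
  noise_r b * fine (P `]y - b, y + b[).

(* Marginal information density
   i(x;P) = \int p_N(y|x) log(p_N(y|x)/p_Y(y;P)) dy  in [0, +oo];
   the integrand vanishes outside (x-b,x+b) (0 log 0 = 0), and equals +oo
   where p_Y(y;P) = 0 inside (x-b,x+b). *)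
Definition info_dens (b : R) (P : probability R R) (x : R) : \bar R :=
  (\int[lebesgue_measure]_(y in `](x - b)%R, (x + b)%R[)
     (if out_dens b P y == 0%R then +oo
      else (noise_r b * ln (noise_r b / out_dens b P y))%:E))%E.

Definition mutual_info (b : R) (P : probability R R) : \bar R :=
  (\int[P]_x info_dens b P x)%E.

Definition cost (alpha x : R) : R := x `^ alpha.

Definition admissible (P : probability R R) : Prop := P `[0, 1] = 1%E.

Definition feasible (alpha cbar : R) (P : probability R R) : Prop :=
  admissible P /\ (\int[P]_(x in `[0%R, 1%R]) (cost alpha x)%:E <= cbar%:E)%E.

Definition capacity_achieving (b alpha cbar : R) (P : probability R R) : Prop :=
  feasible alpha cbar P /\
  forall Q : probability R R, feasible alpha cbar Q ->
    (mutual_info b Q <= mutual_info b P)%E.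

(* Case r = n integer: standard points x_{j+1} = j/n, j = 0..n (0-indexed) *)
Definition std_pt (n : nat) (j : 'I_n.+1) : R := j%:R / n%:R.

(* unconstrained masses m^0_j = 1/(n+1) and critical cost cbar^* *)
Definition crit_cost (n : nat) (alpha : R) : R :=
  \sum_(j < n.+1) (1 / n.+1%:R) * cost alpha (std_pt n j).

Definition gibbs_z (n : nat) (alpha lam : R) : R :=
  \sum_(j < n.+1) expR (- (lam * cost alpha (std_pt n j))).

Definition gibbs_mass (n : nat) (alpha lam : R) (j : 'I_n.+1) : R :=
  expR (- (lam * cost alpha (std_pt n j))) / gibbs_z n alpha lam.

Definition gibbs_distr (n : nat) (alpha lam : R) (A : set R) : \bar R :=
  (\sum_(j < n.+1) gibbs_mass n alpha lam j * \1_A (std_pt n j))%:E.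

End UniformNoiseChannel.

(* Main.v *)
From HB Require Import structures.
Require Import Defs.
From mathcomp Require Import all_boot all_algebra all_classical all_reals all_analysis.
From mathcomp Require Import all_order ring lra measurable_realfun.
Set Implicit Arguments. Unset Strict Implicit. Unset Printing Implicit Defensive.
Import Order.TTheory GRing.Theory Num.Theory.
Import numFieldNormedType.Exports.
Local Open Scope ring_scope.
Local Open Scope classical_set_scope.

(** Write q(y) for the mass that an input distribution P puts on the window
    ]y - b, y + b[, and p for the same quantity computed from the Gibbs masses m_k:
    since the window has the width 1/n of the grid, p is the step function equal to
    m_k on the cell of half-width b around the k-th grid point.  By Tonelli,
    I(P) = \int n q (- ln q), and since q and p both have integral 1/n, the tangent
    inequality q (- ln q) + q <= q (- ln p) + p gives
    I(P) <= \int n q (- ln p).  Using Tonelli again, the right-hand side is the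
    integral against P of the piecewise linear interpolation of
    - ln m_k = lam c_k + ln z, which is at most lam c(x) + ln z by concavity of c.
    So I(P) <= lam cbar + ln z, with equality for the Gibbs distribution.
    Equality for P forces q = p almost everywhere; the cumulative distribution
    function of P is then constant between consecutive grid points, which makes
    m_k the mass of the k-th atom. *)

(** * Tonelli over windows *)

Section windows. Context (R : realType) (b : R).

Lemma mem_oo (u v x : R) : (x \in `]u, v[%classic) = (u < x < v).
Proof. by rewrite mem_setE in_itv. Qed.

Lemma measurable_window : measurable [set xy : R * R | xy.1 - b < xy.2 < xy.1 + b].
Proof.
have -> : [set xy : R * R | xy.1 - b < xy.2 < xy.1 + b] =
    ((fun xy : R * R => xy.2 - xy.1) @^-1` `]-b, b[).
  by apply/seteqP; split=> -[x y] /=; rewrite ?in_itv /= => /andP[? ?];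
    rewrite ?in_itv /=; apply/andP; split; lra.
by rewrite -[X in measurable X]setTI; apply: measurable_funB.
Qed.

Let E := [set xy : R * R | xy.1 - b < xy.2 < xy.1 + b].

Let f (h : R -> \bar R) (xy : R * R) := ((\1_E xy)%:E * h xy.2)%E.

Let measurable_f h : measurable_fun setT h -> measurable_fun setT (f h).
Proof.
move=> mh; apply: emeasurable_funM; last exact: measurableT_comp.
by apply/measurable_EFinP; apply: measurable_indic; exact: measurable_window.
Qed.

Let f_ge0 h : (forall y, (0 <= h y)%E) -> forall xy, (0 <= f h xy)%E.
Proof. by move=> h0 xy; rewrite mule_ge0// lee_fin. Qed.

Let integral_f h (x : R) : (\int[lebesgue_measure]_y f h (x, y) =
  \int[lebesgue_measure]_(y in `](x - b)%R, (x + b)%R[) h y)%E.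
Proof.
rewrite [RHS]integral_mkcond; apply: eq_integral => y _.
rewrite /f patchE indicE /= mem_oo.
have -> : ((x, y) \in E) = (x - b < y < x + b).
  by apply/idP/idP => [|H]; rewrite inE.
by case: ifPn => _; rewrite ?mul1e ?mul0e.
Qed.

(** This function of [x] is the partial integral over [y] in Tonelli's theorem for [f h]. *)
Lemma measurable_window_integral (h : R -> \bar R) :
  measurable_fun setT h -> (forall y, (0 <= h y)%E) ->
  measurable_fun setT (fun x : R =>
    \int[lebesgue_measure]_(y in `](x - b)%R, (x + b)%R[) h y)%E.
Proof.
move=> mh h0.
have := @measurable_fun_fubini_tonelli_F _ _ _ _ _ lebesgue_measure _
  (measurable_f mh) (f_ge0 h0).
by apply: eq_measurable_fun => x _; rewrite /fubini_F integral_f.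
Qed.

(** Both sides integrate [h y] over the strip [E] of pairs at distance less than [b]. The strip is
    symmetric in its two coordinates, so its sections in either direction are windows. *)
Lemma tonelli_window (P : probability R R) (h : R -> \bar R) :
  measurable_fun setT h -> (forall y, (0 <= h y)%E) ->
  (\int[P]_x \int[lebesgue_measure]_(y in `](x - b)%R, (x + b)%R[) h y =
   \int[lebesgue_measure]_y (P `](y - b)%R, (y + b)%R[ * h y))%E.
Proof.
move=> mh h0; under eq_integral do rewrite -integral_f.
have -> := @fubini_tonelli _ _ _ _ _ P lebesgue_measure _
  (measurable_f mh) (f_ge0 h0).
apply: eq_integral => y _.
rewrite /f /= ge0_integralZr//; last first.
  apply/measurable_EFinP; apply: measurableT_comp => //.
  by apply: measurable_indic; exact: measurable_window.
congr (_ * _)%E.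
have -> : (fun x => (\1_E (x, y))%:E) =
    (fun x => (\1_(`](y - b)%R, (y + b)%R[%classic) x)%:E : \bar R).
  apply/funext => x; rewrite !indicE; congr (_%:R%:E); congr nat_of_bool.
  rewrite mem_oo; apply/idP/idP => [|/andP[? ?]]; rewrite inE /E /=.
    by move=> /andP[? ?]; apply/andP; split; lra.
  by apply/andP; split; lra.
by rewrite integral_indic// setIT.
Qed.

Lemma measurable_window_prob (P : probability R R) :
  measurable_fun setT (fun y : R => P `](y - b)%R, (y + b)%R[).
Proof.
have := measurable_fun_ysection P measurable_window.
apply: eq_measurable_fun => y _ /=; congr (P _).
apply/seteqP; split => x; rewrite /ysection /= in_itv /=.
  by rewrite inE /= => /andP[? ?]; apply/andP; split; lra.
by move=> /andP[? ?]; rewrite inE /=; apply/andP; split; lra.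
Qed.
End windows.

(** * Scalar inequalities *)

Section scalar_inequalities. Context {R : realType}.
Implicit Types (a t x y p q alpha : R).

(** The power with exponent [alpha^-1 >= 1] is convex. Convexity at the [alpha]-th powers of [x] and
    [y], followed by the increasing map that raises to [alpha], gives the claim. *)
Lemma concave_powR alpha t x y : 0 < alpha -> alpha <= 1 -> 0 <= t -> t <= 1 ->
  0 <= x -> 0 <= y ->
  t * x `^ alpha + (1 - t) * y `^ alpha <= (t * x + (1 - t) * y) `^ alpha.
Proof.
move=> a0 a1 t0 t1 x0 y0.
have ia : 1 <= alpha^-1 by rewrite invf_ge1.
have cvx := @convex_powR R _ ia (Itv01 t0 t1) (x `^ alpha) (y `^ alpha).
have {}cvx := cvx (mem_set _) (mem_set _).
rewrite /= !in_itv /= !andbT !powR_ge0 in cvx.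
have {cvx} H := cvx isT isT.
have {}H : (t * x `^ alpha + (1 - t) * y `^ alpha) `^ alpha^-1 <=
    t * x + (1 - t) * y.
  have inv z : 0 <= z -> (z `^ alpha) `^ alpha^-1 = z.
    by move=> z0; rewrite -powRrM divff ?gt_eqF// powRr1.
  by rewrite -[X in _ <= t * X + _](inv _ x0) -[X in _ <= _ + _ * X](inv _ y0).
have s0 : 0 <= t * x `^ alpha + (1 - t) * y `^ alpha.
  by rewrite addr_ge0// mulr_ge0// ?powR_ge0// subr_ge0.
have := @ge0_ler_powR _ alpha (ltW a0) _ _ _ _ H.
rewrite -powRrM mulVf ?gt_eqF// powRr1//; apply; rewrite nnegrE ?powR_ge0//.
by rewrite addr_ge0// mulr_ge0// subr_ge0.
Qed.

(** For [q > 0] this is [1 + u <= expR u] at [u = ln (p / q)], multiplied by [q]; for [q = 0] it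
    reduces to [0 <= p]. *)
Lemma entropy_tangent_le p q : 0 <= q -> 0 < p ->
  q * - ln q + q <= q * - ln p + p.
Proof.
rewrite le_eqVlt => /predU1P[<-|q0] p0; first by rewrite !mul0r !add0r ltW.
have := expR_ge1Dx (ln (p / q)); rewrite lnK ?posrE ?divr_gt0// ln_div ?posrE//.
move=> /(ler_wpM2l (ltW q0)); rewrite mulrCA divff ?gt_eqF// mulr1; lra.
Qed.

(** For [q > 0], strictness of [1 + u < expR u] at every [u != 0] forces [ln (p / q) = 0]. *)
Lemma entropy_tangent_eq p q : 0 <= q -> 0 < p ->
  q * - ln q + q = q * - ln p + p -> q = p.
Proof.
rewrite le_eqVlt => /predU1P[<-|q0] p0; first by rewrite !mul0r !add0r.
have [/eqP|lpq] := eqVneq (ln (p / q)) 0.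
  rewrite ln_eq0 ?divr_gt0// => /eqP/(congr1 ( *%R^~ q)).
  by rewrite divfK ?gt_eqF// mul1r.
have := expR_gt1Dx lpq; rewrite lnK ?posrE ?divr_gt0// ln_div ?posrE//.
rewrite -(ltr_pM2l q0) mulrCA divff ?gt_eqF// mulr1 => H E; exfalso; move: H E; lra.
Qed.
End scalar_inequalities.

(** * Step functions on the grid *)

Section cells. Context {R : realType}.
Implicit Types (b x y : R) (k n : nat) (v : nat -> R).

(** The spacing is the width of a noise window; it is [1 / n] once [n%:R * (2 * b) = 1], and the
    nodes up to [n] are then the standard points. *)
Definition node b k : R := k%:R * (2 * b).

(** Half-open, so that the cells tile the line from [- b] on without overlap and each point there
    has exactly one value of [step]. *)
Definition cell b k : set R := `[node b k - b, node b k + b[%classic.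

Definition step b n v y : R := \sum_(k < n.+1) v k * \1_(cell b k) y.

Lemma nodeS b k : node b k.+1 = node b k + 2 * b.
Proof. by rewrite /node -natr1 mulrDl mul1r. Qed.

Lemma node0 b : node b 0 = 0. Proof. by rewrite /node mul0r. Qed.

Lemma le_node b j k : 0 < b -> (j <= k)%N -> node b j <= node b k.
Proof. by move=> b0 jk; rewrite ler_wpM2r ?ler_nat// mulr_ge0// ltW. Qed.

Lemma cell_inj b j k y : 0 < b -> cell b j y -> cell b k y -> j = k.
Proof.
move=> b0; rewrite /cell /= !in_itv /= => /andP[j1 j2] /andP[k1 k2].
case: (ltngtP j k) => // /(le_node b0); rewrite nodeS => ?; exfalso; lra.
Qed.

Lemma cell_exists b n y : 0 < b -> - b <= y -> y < node b n + b ->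
  exists2 k, (k <= n)%N & cell b k y.
Proof.
move=> b0 y1 y2; have w0 : 0 < 2 * b by rewrite mulr_gt0.
have /truncn_itv : 0 <= (y + b) / (2 * b) by rewrite divr_ge0 ?(ltW w0)//; lra.
set k := Num.trunc _; rewrite ler_pdivlMr// ltr_pdivrMr// -!/(node b _) nodeS.
move=> /andP[k1 k2]; exists k.
  rewrite leqNgt; apply/negP => /(le_node b0); rewrite nodeS; lra.
by rewrite /cell /= in_itv /=; apply/andP; split; lra.
Qed.

Lemma measurable_cell b k : measurable (cell b k).
Proof. exact: measurable_itv. Qed.

Lemma stepE b n v k y : 0 < b -> (k <= n)%N -> cell b k y -> step b n v y = v k.
Proof.
move=> b0 kn yk; have kn' : (k < n.+1)%N by [].
rewrite /step (bigD1 (Ordinal kn'))//= indicE mem_set// mulr1 big1 ?addr0// => j jk.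
rewrite indicE memNset ?mulr0// => yj; move: jk; rewrite -val_eqE /=.
by rewrite (cell_inj b0 yj yk) eqxx.
Qed.

Lemma step_out b n v y : 0 < b -> y < - b \/ node b n + b <= y -> step b n v y = 0.
Proof.
move=> b0 yb; rewrite /step big1// => j _; rewrite indicE memNset ?mulr0//.
rewrite /cell /= in_itv /= => /andP[j1 j2].
have := le_node b0 (leq0n j); have : (j <= n)%N by rewrite -ltnS.
by rewrite node0 => /(le_node b0); case: yb; lra.
Qed.

Lemma measurable_step b n v : measurable_fun setT (step b n v).
Proof.
apply: measurable_sum => k; apply: measurable_funM => //.
by apply: measurable_indic; exact: measurable_cell.
Qed.

Lemma step_ge0 b n v y : (forall k, (k <= n)%N -> 0 <= v k) -> 0 <= step b n v y.
Proof. by move=> v0; apply: sumr_ge0 => k _; rewrite mulr_ge0// v0// -ltnS. Qed.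

Lemma measure_itv_co x y : x <= y ->
  (lebesgue_measure (`[x, y[%classic : set R) = (y - x)%:E)%E.
Proof.
rewrite le_eqVlt => /predU1P[<-|xy]; rewrite lebesgue_measure_itv /=.
  by rewrite ltxx subrr.
by rewrite lte_fin xy EFinB.
Qed.

Lemma integral_step b n v : 0 < b -> (forall k, (k <= n)%N -> 0 <= v k) ->
  (\int[lebesgue_measure]_y (step b n v y)%:E = (\sum_(k < n.+1) v k * (2 * b))%:E)%E.
Proof.
move=> b0 v0; rewrite /step.
under eq_integral do rewrite -sumEFin.
rewrite ge0_integral_sum//; last 2 first.
- move=> k; apply/measurable_EFinP; apply: measurable_funM => //.
  by apply: measurable_indic; exact: measurable_cell.
- by move=> k x _; rewrite lee_fin mulr_ge0// v0// -ltnS.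
rewrite -sumEFin; apply: eq_bigr => k _.
under eq_integral do rewrite EFinM.
rewrite ge0_integralZl//; last 2 first.
- by apply/measurable_EFinP; apply: measurable_indic; exact: measurable_cell.
- by rewrite lee_fin v0// -ltnS.
rewrite integral_indic ?setIT//; last exact: measurable_cell.
rewrite /cell /= measure_itv_co ?EFinM; last lra.
by congr (_ * _%:E)%E; ring.
Qed.

(** The window around a point between nodes [k] and [k.+1] meets only these two cells. Their border
    [node b k + b] cuts it into lengths [node b k.+1 - x] and [x - node b k], so the integral is
    [2 * b] times the linear interpolation of [v]. *)
Lemma integral_window_step b n v k x : 0 < b -> (forall k, (k <= n)%N -> 0 <= v k) ->
  (k < n)%N -> node b k <= x -> x <= node b k.+1 ->
  (\int[lebesgue_measure]_(y in `](x - b)%R, (x + b)%R[) (step b n v y)%:E =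
   (v k * (node b k.+1 - x) + v k.+1 * (x - node b k))%:E)%E.
Proof.
move=> b0 v0 kn; rewrite nodeS => x1 x2.
have mE (D : set R) : measurable_fun D (EFin \o step b n v).
  by apply: measurable_funTS; apply/measurable_EFinP; exact: measurable_step.
(* Adding the left endpoint keeps the integral and makes both pieces half-open, like the cells. *)
rewrite -(@integral_itv_bndoo _ _ _ _ true true)//.
rewrite (@itv_bndbnd_setU _ _ _ (BLeft (node b k + b)))//=; last 2 first.
- by rewrite bnd_simp; lra.
- by rewrite bnd_simp; lra.
rewrite ge0_integral_setU//=; last 3 first.
- exact: mE.
- by move=> y _; rewrite lee_fin step_ge0.
- apply/disj_setPS => y /=; rewrite !in_itv /= => -[/andP[h1 h2] /andP[h3 h4]].
  lra.
rewrite EFinD; congr (_ + _)%E.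
- rewrite (@eq_integral _ _ _ _ _ (cst (v k)%:E)).
    by rewrite integral_cst//= measure_itv_co ?EFinM; [congr (_ * _%:E)%E; ring|lra].
  move=> y; rewrite inE /= in_itv /= => /andP[h1 h2].
  rewrite (stepE _ b0 (ltnW kn))// /cell /= in_itv /=; apply/andP; split; lra.
- rewrite (@eq_integral _ _ _ _ _ (cst (v k.+1)%:E)).
    by rewrite integral_cst//= measure_itv_co ?EFinM; [congr (_ * _%:E)%E; ring|lra].
  move=> y; rewrite inE /= in_itv /= => /andP[h1 h2].
  rewrite (stepE _ b0 kn)// /cell /= in_itv /= nodeS; apply/andP; split; lra.
Qed.
End cells.

(** * Mutual information as an entropy *)

Section information. Context {R : realType} (b : R) (P : probability R R).
Hypothesis b0 : 0 < b.

Local Notation mu := (@lebesgue_measure R).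

Definition window_mass (y : R) : R := fine (P `]y - b, y + b[).

Lemma window_massE y : P `]y - b, y + b[%classic = (window_mass y)%:E.
Proof. by rewrite /window_mass fineK// fin_num_measure. Qed.

Lemma window_mass_ge0 y : 0 <= window_mass y.
Proof. exact/fine_ge0/measure_ge0. Qed.

Lemma window_mass_le1 y : window_mass y <= 1.
Proof. by rewrite -lee_fin -window_massE probability_le1. Qed.

Lemma measurable_window_mass : measurable_fun setT window_mass.
Proof.
apply/measurable_EFinP; apply: eq_measurable_fun (measurable_window_prob b P).
by move=> y _; rewrite /= window_massE.
Qed.

Lemma noise_r_gt0 : 0 < noise_r b.
Proof. by rewrite /noise_r divr_gt0// mulr_gt0. Qed.

Let neg_ln_ge0 q : 0 <= q -> q <= 1 -> 0 <= - ln q :> R.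
Proof. by move=> q0 q1; rewrite oppr_ge0 ln_le0. Qed.

Let h (y : R) : \bar R := if out_dens b P y == 0 then +oo%E
  else (noise_r b * ln (noise_r b / out_dens b P y))%:E.

Let out_dens_eq0 y : (out_dens b P y == 0) = (window_mass y == 0).
Proof. by rewrite /out_dens mulf_eq0 gt_eqF ?noise_r_gt0. Qed.

Lemma ln_out_densE y : window_mass y != 0 ->
  ln (noise_r b / out_dens b P y) = - ln (window_mass y).
Proof.
move=> q0; have r0 := noise_r_gt0; have q_gt0 : 0 < window_mass y.
  by rewrite lt_neqAle eq_sym q0 window_mass_ge0.
rewrite /out_dens -/(window_mass y) invfM mulrA mulfV ?gt_eqF// mul1r.
by rewrite lnV// posrE.
Qed.

Let hE y : h y = if window_mass y == 0 then +oo%E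
  else (noise_r b * - ln (window_mass y))%:E.
Proof. by rewrite /h out_dens_eq0; case: ifPn => // q0; rewrite ln_out_densE. Qed.

Let h_ge0 y : (0 <= h y)%E.
Proof.
rewrite hE; case: ifPn => // q0; rewrite lee_fin.
by rewrite mulr_ge0 ?(ltW noise_r_gt0)// neg_ln_ge0 ?window_mass_ge0 ?window_mass_le1.
Qed.

Let measurable_h : measurable_fun setT h.
Proof.
rewrite (funext hE); apply: measurable_fun_ifT => //.
- by apply: measurable_fun_eqr => //; exact: measurable_window_mass.
- apply/measurable_EFinP; apply: measurable_funM => //; apply: measurableT_comp => //.
  apply: measurableT_comp; first exact: measurable_ln.
  exact: measurable_window_mass.
Qed.

Lemma mutual_info_entropy : mutual_info b P =
  (\int[mu]_y (noise_r b * (window_mass y * - ln (window_mass y)))%:E)%E.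
Proof.
rewrite /mutual_info /info_dens (tonelli_window b P measurable_h h_ge0).
apply: eq_integral => y _; rewrite window_massE hE.
(* Where the window is empty of mass, the infinite density is multiplied by zero, in agreement with
   the entropy term at [0]. *)
case: ifPn => [/eqP ->|q0]; first by rewrite !mul0r mulr0 mul0e.
by rewrite -EFinM mulrCA.
Qed.

Lemma measurable_info_dens : measurable_fun setT (info_dens b P).
Proof. exact: measurable_window_integral. Qed.

Lemma info_dens_ge0 x : (0 <= info_dens b P x)%E.
Proof. by apply: integral_ge0 => y _; exact: h_ge0. Qed.

(** Tonelli with a constant integrand: every window has length [2 * b], the inverse of
    [noise_r b]. *)
Lemma integral_window_mass : (\int[mu]_y (noise_r b * window_mass y)%:E = 1)%E.
Proof.
have r0 := noise_r_gt0.
under eq_integral do rewrite mulrC EFinM -window_massE.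
rewrite -(@tonelli_window _ b P (cst (noise_r b)%:E))//; last by rewrite /= lee_fin ltW.
rewrite (@eq_integral _ _ _ _ _ (cst 1%E)).
  by rewrite integral_cst// mul1e; exact: probability_setT.
move=> x _; rewrite integral_cst//= lebesgue_measure_itv /= lte_fin.
rewrite ltrD2l gtrN//.
rewrite -EFinB -EFinM /noise_r; congr _%:E; field.
by rewrite gt_eqF.
Qed.

Lemma integral_window_mass_step n v : admissible P ->
  (forall k, (k <= n)%N -> 0 <= v k) ->
  (\int[mu]_y (window_mass y * step b n v y)%:E =
   \int[P]_(x in `[0%R, 1%R])
     \int[mu]_(y in `](x - b)%R, (x + b)%R[) (step b n v y)%:E)%E.
Proof.
move=> P01 v0.
under eq_integral do rewrite EFinM -window_massE.
have mv : measurable_fun setT (EFin \o step b n v).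
  by apply/measurable_EFinP; exact: measurable_step.
rewrite -(@tonelli_window _ b P (EFin \o step b n v))//=; last first.
  by move=> y; rewrite lee_fin step_ge0.
rewrite (@ge0_negligible_integral _ _ _ _ _ (~` (`[0%R, 1%R]%classic : set R)))//=.
- by rewrite setTD setCK.
- exact: measurableC.
- by apply: (measurable_window_integral b mv) => y; rewrite lee_fin step_ge0.
- by move=> x _; apply: integral_ge0 => y _; rewrite lee_fin step_ge0.
- rewrite probability_setC// P01; exact: subee.
Qed.
End information.

(** * Gibbs inequality and interpolated cost *)

Section duality. Context {R : realType} (b : R) (n : nat) (P : probability R R).
Hypotheses (b0 : 0 < b) (nb : n%:R * (2 * b) = 1) (P01 : admissible P).

Local Notation mu := (@lebesgue_measure R).
Local Notation q := (window_mass b P).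

Let node_n : node b n = 1. Proof. exact: nb. Qed.

Lemma probability_outside (A : set R) :
  measurable A -> A `&` `[0, 1] = set0 -> P A = 0%E.
Proof.
move=> mA A01; apply/eqP; rewrite eq_le measure_ge0 andbT.
have <- : P (~` `[0, 1]) = 0%E.
  by rewrite probability_setC// P01; exact: subee.
apply: le_measure; rewrite ?inE//; first exact: measurableC.
by apply/disjoints_subset.
Qed.

Lemma window_mass_out y : y < - b \/ 1 + b <= y -> q y = 0.
Proof.
move=> yb; rewrite /window_mass probability_outside//.
rewrite -subset0 => x /= []; rewrite !in_itv /= => /andP[? ?] /andP[? ?].
by case: yb => ?; lra.
Qed.

Variable m : nat -> R.
Hypotheses (m0 : forall k, (k <= n)%N -> 0 < m k) (m1 : \sum_(k < n.+1) m k = 1).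

Local Notation p := (step b n m).
Local Notation g := (step b n (fun k => - ln (m k))).

Lemma mass_le1 k : (k <= n)%N -> m k <= 1.
Proof.
move=> kn; have kn' : (k < n.+1)%N by [].
rewrite -m1 (bigD1 (Ordinal kn'))//= lerDl sumr_ge0// => j _.
by rewrite ltW// m0// -ltnS.
Qed.

Lemma neg_ln_mass_ge0 k : (k <= n)%N -> 0 <= - ln (m k).
Proof. by move=> kn; rewrite oppr_ge0 ln_le0// mass_le1. Qed.

(** On a cell [g] is [- ln p] and the tangent inequality applies. Off the cells [q] vanishes because
    [P] lives on the unit interval, and [p] vanishes by construction. *)
Lemma window_tangent_le y : q y * - ln (q y) + q y <= q y * g y + p y.
Proof.
have [/andP[y1 y2]|/negP yb] := boolP ((- b <= y) && (y < 1 + b)).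
  have [|k kn yk] := @cell_exists _ b n y b0 y1; first by rewrite node_n.
  by rewrite !(stepE _ b0 kn yk) entropy_tangent_le ?window_mass_ge0 ?m0.
have {}yb : y < - b \/ 1 + b <= y.
  have [|y1] := ltP y (- b); first by left.
  by right; rewrite leNgt; apply/negP => y2; apply: yb; rewrite y1.
by rewrite window_mass_out// !mul0r !add0r step_out// node_n.
Qed.

Lemma window_tangent_eq y : q y * - ln (q y) + q y = q y * g y + p y -> q y = p y.
Proof.
have [/andP[y1 y2]|/negP yb] := boolP ((- b <= y) && (y < 1 + b)).
  have [|k kn yk] := @cell_exists _ b n y b0 y1; first by rewrite node_n.
  by rewrite !(stepE _ b0 kn yk); apply: entropy_tangent_eq;
    rewrite ?window_mass_ge0 ?m0.
have {}yb : y < - b \/ 1 + b <= y.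
  have [|y1] := ltP y (- b); first by left.
  by right; rewrite leNgt; apply/negP => y2; apply: yb; rewrite y1.
by rewrite window_mass_out// (@step_out _ b n m)// node_n.
Qed.

Local Notation r := (noise_r b).

Let r_ge0 : 0 <= r. Proof. exact/ltW/noise_r_gt0. Qed.

Let p_ge0 y : 0 <= p y. Proof. by apply: step_ge0 => k kn; rewrite ltW ?m0. Qed.

Let g_ge0 y : 0 <= g y. Proof. by apply: step_ge0; exact: neg_ln_mass_ge0. Qed.

Let q_ge0 y : 0 <= q y. Proof. exact: window_mass_ge0. Qed.

Let lnq_ge0 y : 0 <= q y * - ln (q y).
Proof. by rewrite mulr_ge0// oppr_ge0 ln_le0// window_mass_le1. Qed.

Let mq : measurable_fun setT q. Proof. exact: measurable_window_mass. Qed.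
Let mp : measurable_fun setT p. Proof. exact: measurable_step. Qed.
Let mg : measurable_fun setT g. Proof. exact: measurable_step. Qed.

Let mlnq : measurable_fun setT (fun y => q y * - ln (q y)).
Proof.
apply: measurable_funM => //; apply: measurableT_comp => //.
by apply: measurableT_comp => //; exact: measurable_ln.
Qed.

Let mqg : measurable_fun setT (fun y => q y * g y).
Proof. exact: measurable_funM. Qed.

Let mr (f : R -> R) : measurable_fun setT f ->
  measurable_fun setT (fun y => (r * f y)%:E).
Proof. by move=> mf; apply/measurable_EFinP; exact: measurable_funM. Qed.

Let integral_p : (\int[mu]_y (r * p y)%:E = 1)%E.
Proof.
under eq_integral do rewrite EFinM.
rewrite ge0_integralZl//; last 2 first.
- exact/measurable_EFinP.
- by move=> y _; rewrite lee_fin.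
rewrite integral_step//; last by move=> k kn; rewrite ltW ?m0.
rewrite -mulr_suml m1 mul1r -EFinM /noise_r; congr _%:E; field.
by rewrite gt_eqF.
Qed.

(** The pointwise defect in the tangent inequality; its integral measures how far [P] is from
    equality. *)
Let w y := q y * g y + p y - (q y * - ln (q y) + q y).

Let w_ge0 y : 0 <= w y. Proof. by rewrite subr_ge0 window_tangent_le. Qed.

Let mw : measurable_fun setT w.
Proof. by apply: measurable_funB; exact: measurable_funD. Qed.

Lemma entropy_gap :
  (\int[mu]_y (r * (q y * - ln (q y)))%:E + \int[mu]_y (r * w y)%:E =
   \int[mu]_y (r * (q y * g y))%:E)%E.
Proof.
(* The [1] stands for the integral of [r * q] on the left and of [r * p] on the right. With it only
   non-negative integrands are added, as extended reals require; being finite, it cancels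
   afterwards. *)
have E : (\int[mu]_y (r * (q y * - ln (q y)))%:E + \int[mu]_y (r * w y)%:E + 1
    = \int[mu]_y (r * (q y * g y))%:E + 1)%E.
  rewrite -[X in (_ + X = _)%E](integral_window_mass P b0)
    -[X in (_ = _ + X)%E]integral_p.
  have ge0 (f : R -> R) : (forall y, 0 <= f y) ->
      forall y, setT y -> (0 <= (r * f y)%:E)%E.
    by move=> f0 y _; rewrite lee_fin mulr_ge0.
  have qg_ge0 y : 0 <= q y * g y by rewrite mulr_ge0.
  rewrite -!ge0_integralD//; try exact: mr; try exact: ge0.
  - by apply: eq_integral => y _; rewrite -!EFinD; congr _%:E; rewrite /w; ring.
  - by move=> y _; rewrite -EFinD lee_fin addr_ge0// mulr_ge0.
  - by apply: emeasurable_funD; exact: mr.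
by have := congr1 (fun z => z - 1)%E E; rewrite !addeK.
Qed.

Lemma mutual_info_le_cross_entropy :
  (mutual_info b P <= \int[mu]_y (r * (q y * g y))%:E)%E.
Proof.
rewrite mutual_info_entropy// -entropy_gap leeDl// integral_ge0// => y _.
by rewrite lee_fin mulr_ge0.
Qed.

(** Finite information can be cancelled in [entropy_gap]. The defect [w] then has integral zero, so
    it vanishes almost everywhere, which is the equality case of the tangent inequality. *)
Lemma mutual_info_eq_cross_entropy :
  mutual_info b P = (\int[mu]_y (r * (q y * g y))%:E)%E ->
  mutual_info b P \is a fin_num -> {ae mu, forall y, q y = p y}.
Proof.
move=> IE Ifin; have := entropy_gap; rewrite -mutual_info_entropy// -IE => E.
have W0 : (\int[mu]_y (r * w y)%:E = 0)%E.
  by have := congr1 (fun z => z - mutual_info b P)%E E; rewrite addeAC subee// add0e.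
have {}W0 : (\int[mu]_y `|(r * w y)%:E| = 0)%E.
  by rewrite -W0; apply: eq_integral => y _; rewrite gee0_abs// lee_fin mulr_ge0.
have /(@ae_eq_integral_abs _ _ _ mu setT measurableT _ (mr mw)) := W0.
apply: filterS => y /(_ I) /eqP.
rewrite eqe mulf_eq0 gt_eqF ?noise_r_gt0//= subr_eq0 => /eqP/esym.
exact: window_tangent_eq.
Qed.

Variables (alpha lam cbar l : R).
Hypotheses (al0 : 0 < alpha) (al1 : alpha <= 1) (lam0 : 0 <= lam) (l0 : 0 <= l).
Hypothesis mE : forall k, (k <= n)%N -> - ln (m k) = lam * cost alpha (node b k) + l.
Hypothesis Pcost : (\int[P]_(x in `[0%R, 1%R]) (cost alpha x)%:E <= cbar%:E)%E.

(** The left-hand side is [2 * b] times the interpolation of [- ln (m k)] between the nodes around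
    [x]. By concavity the chord of the cost lies below the cost; [l] plays the role of [ln z]. *)
Lemma window_step_cost x : 0 <= x -> x <= 1 ->
  (\int[mu]_(y in `](x - b)%R, (x + b)%R[) (g y)%:E <=
   (2 * b * (lam * cost alpha x + l))%:E)%E.
Proof.
move=> x0 x1; have w0 : 0 < 2 * b by rewrite mulr_gt0.
have [k kn /andP[k1 k2]] : exists2 k, (k < n)%N & node b k <= x <= node b k.+1.
  have n0 : (0 < n)%N by case: n nb => // /eqP; rewrite mul0r eq_sym oner_eq0.
  (* That [x - b] lies in cell [k] means that [x] lies between nodes [k] and [k.+1]. *)
  have [||k kn] := @cell_exists _ b n (x - b) b0; [lra|rewrite node_n; lra|].
  rewrite /cell /= in_itv /= => /andP[k1 k2].
  have [kn'|] := ltnP k n; first by exists k => //;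
    rewrite nodeS; apply/andP; split; lra.
  (* Only [x = 1] remains; it is the right end of the last interval. *)
  move=> nk; have kE : k = n by apply/eqP; rewrite eqn_leq kn.
  exists n.-1; first by rewrite prednK.
  rewrite prednK// node_n x1 andbT; apply: le_trans (_ : node b k <= _); last lra.
  by apply: le_node => //; rewrite kE leq_pred.
rewrite (integral_window_step b0 neg_ln_mass_ge0 kn k1 k2)
  lee_fin !mE//; last exact: ltnW.
set t := (node b k.+1 - x) / (2 * b).
have te : node b k.+1 - x = 2 * b * t by rewrite /t mulrC divfK ?gt_eqF.
have t' : x - node b k = 2 * b * (1 - t) by rewrite mulrBr mulr1 -te nodeS; ring.
rewrite te t'.
have t0 : 0 <= t by rewrite divr_ge0 ?subr_ge0// ltW.
have t1 : t <= 1 by rewrite -subr_ge0 -(pmulr_rge0 _ w0) -t' subr_ge0.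
have xE : x = t * node b k + (1 - t) * node b k.+1.
  by move: t'; rewrite nodeS => /eqP; rewrite subr_eq => /eqP {1}->; ring.
have nge0 j : 0 <= node b j by rewrite mulr_ge0// ltW.
have := concave_powR al0 al1 t0 t1 (nge0 k) (nge0 k.+1).
rewrite -xE /cost => /(ler_wpM2l lam0) H.
rewrite (_ : _ + _ = 2 * b * (lam * (t * node b k `^ alpha +
  (1 - t) * node b k.+1 `^ alpha) + l)); last ring.
by rewrite ler_wpM2l ?(ltW w0)// lerD2r.
Qed.

(** Tonelli moves the integral onto [P], where the factor [r] cancels the [2 * b] of
    [window_step_cost]; the cost constraint and the total mass [1] give the two terms. *)
Lemma cross_entropy_le : (\int[mu]_y (r * (q y * g y))%:E <= (lam * cbar + l)%:E)%E.
Proof.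
have r0 := noise_r_gt0 b0.
under eq_integral do rewrite EFinM.
rewrite ge0_integralZl//; last 2 first.
- exact/measurable_EFinP.
- by move=> y _; rewrite lee_fin mulr_ge0.
rewrite (integral_window_mass_step b P01); last exact: neg_ln_mass_ge0.
have mc : measurable_fun setT (cost alpha) by exact: measurable_powR.
have mlc : measurable_fun setT (fun x => lam * cost alpha x + l).
  by apply: measurable_funD => //; exact: measurable_funM.
have c0 x : 0 <= lam * cost alpha x by rewrite mulr_ge0// powR_ge0.
apply: (@le_trans _ _ (r%:E *
    \int[P]_(x in `[0%R, 1%R]) (2 * b * (lam * cost alpha x + l))%:E)%E).
  rewrite lee_pmul2l//.
  apply: ge0_le_integral => //.
  - by move=> x _; apply: integral_ge0 => y _; rewrite lee_fin.
  - apply: measurable_funTS; apply: measurable_window_integral;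
      first exact/measurable_EFinP.
    by move=> y; rewrite lee_fin.
  - by apply: measurable_funTS; apply/measurable_EFinP; exact: measurable_funM.
  - by move=> x /=; rewrite in_itv /= => /andP[? ?]; exact: window_step_cost.
under eq_integral do rewrite (EFinM (2 * b)) EFinD (EFinM lam).
rewrite ge0_integralZl//; last 3 first.
- apply: measurable_funTS; apply: emeasurable_funD => //.
  by apply/measurable_EFinP; exact: measurable_funM.
- by move=> x _; rewrite lee_fin addr_ge0.
- by rewrite lee_fin mulr_ge0// ltW.
rewrite ge0_integralD//; last 2 first.
- by move=> x _; rewrite lee_fin.
- by apply: measurable_funTS; apply/measurable_EFinP; exact: measurable_funM.
rewrite ge0_integralZl//; last 2 first.
- by apply: measurable_funTS; exact/measurable_EFinP.
- by move=> x _; rewrite lee_fin powR_ge0.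
rewrite integral_cst// [X in (_ + _ * X)%E]P01 mule1 muleA -EFinM
  (_ : r * (2 * b) = 1) ?mul1e; last first.
  by rewrite /noise_r; field; rewrite gt_eqF.
by rewrite EFinD leeD2r// EFinM lee_wpmul2l// lee_fin.
Qed.
End duality.

(** * Discrete distributions *)

Section discrete_probability.
Context d (T : measurableType d) (R : realType) (n : nat) (m : nat -> R) (a : nat -> T).
Hypotheses (m0 : forall k, 0 <= m k) (m1 : \sum_(k < n) m k = 1).

Let mu : {measure set T -> \bar R} := msum (fun k => mscale (NngNum (m0 k)) \d_(a k)) n.

(* The proof argument is there for the probability instance on [discrete m1] to
   find it. *)
Definition discrete (_ : \sum_(k < n) m k = 1) : set T -> \bar R := mu.

Local Notation D := (discrete m1).

Let discreteE A : mu A = (\sum_(k < n) m k * \1_A (a k))%:E.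
Proof.
rewrite /mu /= /msum -sumEFin; apply: eq_bigr => k _.
by rewrite /mscale /= /dirac EFinM.
Qed.

Let discrete_setT : mu setT = 1%E.
Proof.
rewrite discreteE; congr _%:E; rewrite -m1; apply: eq_bigr => k _.
by rewrite indicT mulr1.
Qed.

HB.instance Definition _ := Measure.on D.

HB.instance Definition _ := @Measure_isProbability.Build _ _ _ D discrete_setT.

Lemma discrete_probability_exists : exists P : probability T R,
    (forall A, P A = (\sum_(k < n) m k * \1_A (a k))%:E) /\
    (forall D f, measurable D -> measurable_fun D f -> (forall x, D x -> 0 <= f x)%E ->
      \int[P]_(x in D) f x = \sum_(k < n) (m k)%:E * (\d_(a k) D * f (a k)))%E.
Proof.
exists D; split=> [A|E f mE f0 fE]; first exact: discreteE.
rewrite (_ : (D : set T -> \bar R) = mu)//.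
rewrite ge0_integral_measure_sum//; apply: eq_bigr => k _.
by rewrite ge0_integral_mscale// integral_dirac.
Qed.
End discrete_probability.

Lemma ae_exists_itv (R : realType) (Q : R -> Prop) (u v : R) :
  {ae (@lebesgue_measure R), forall y, Q y} -> u < v -> exists2 y, u < y < v & Q y.
Proof.
move=> [N [mN N0 subN]] uv; apply: contrapT => nex.
have sub : `]u, v[%classic `<=` N.
  move=> y /=; rewrite in_itv /= => yuv; apply: subN => Qy; apply: nex.
  by exists y.
have : (lebesgue_measure (`]u, v[%classic : set R) <= 0)%E.
  by rewrite -N0; apply: le_measure; rewrite ?inE.
by rewrite lebesgue_measure_itv /= lte_fin uv -EFinB lee_fin subr_le0 leNgt uv.
Qed.

(** * Uniqueness *)

(** The atoms bound [P] from below on every measurable set. Since the masses already sum to [1], the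
    same bound on the complement is the upper bound. *)
Lemma probability_of_atoms d (T : measurableType d) (R : realType) n
    (P : probability T R) (m : nat -> R) (a : nat -> T) (A : set T) :
  injective a -> (forall k, measurable [set a k]) ->
  (forall k, (k < n)%N -> ((m k)%:E <= P [set a k])%E) -> \sum_(k < n) m k = 1 ->
  measurable A -> P A = (\sum_(k < n) m k * \1_A (a k))%:E.
Proof.
move=> ainj ma mP m1.
have lb B : measurable B -> ((\sum_(k < n) m k * \1_B (a k))%:E <= P B)%E.
  move=> mB; pose F k := B `&` [set a k].
  have mF k : measurable (F k) by exact: measurableI.
  have tF : trivIset [set: nat] F.
    by move=> i j _ _ [x [[_ /= ->] [_ /=]]] /ainj.
  apply: (@le_trans _ _ (P (\big[setU/set0]_(k < n) F k))); last first.
    apply: le_measure; rewrite ?inE//; first exact: bigsetU_measurable.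
    by rewrite -bigcup_mkord => x [k _ []].
  rewrite measure_bigsetU// -sumEFin; apply: lee_sum => k _.
  rewrite indicE; have [/set_mem aB|aB] := boolP (a k \in B).
    rewrite mulr1 (_ : F k = [set a k]) ?mP// /F.
    by apply/seteqP; split => [x []//|x /= ->].
  by rewrite mulr0.
move=> mA; apply/eqP; rewrite eq_le lb// andbT.
have := lb _ (measurableC mA); rewrite probability_setC//.
have -> : \sum_(k < n) m k * \1_(~` A) (a k) = 1 - \sum_(k < n) m k * \1_A (a k).
  rewrite -m1 -sumrB; apply: eq_bigr => k _; rewrite !indicE in_setC.
  by case: (_ \in A); rewrite ?mulr0 ?mulr1 ?subrr ?subr0.
rewrite -(fineK (fin_num_measure P A mA)) -EFinB !lee_fin; lra.
Qed.

Section uniqueness. Context {R : realType} (b : R) (n : nat) (P : probability R R).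
Hypotheses (b0 : 0 < b) (P01 : admissible P).
Variable m : nat -> R.
Hypothesis m1 : \sum_(k < n.+1) m k = 1.
Hypothesis qm : {ae (@lebesgue_measure R), forall y,
  window_mass b P y = step b n m y}.

(** The left-continuous distribution function; excluding [s] makes its increments the masses of
    intervals closed on the left and open on the right. *)
Let F (s : R) := P `]-oo, s[%classic.

Let le_F s t : s <= t -> (F s <= F t)%E.
Proof.
move=> st; apply: le_measure; rewrite ?inE//.
by move=> x /=; rewrite !in_itv /= => /lt_le_trans; apply.
Qed.

Let FD s t : s <= t -> (F t = F s + P `[s, t[%classic)%E.
Proof.
move=> st; rewrite /F (@itv_bndbnd_setU _ _ _ (BLeft s))//.
rewrite measureU// -subset0 => x [] /=; rewrite !in_itv /= => xs /andP[sx _].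
by move: (lt_le_trans xs sx); rewrite ltxx.
Qed.

(** Induction on the number [k] of nodes below [s]. The window of mass [m k] that ends at a point
    past node [k] begins in the previous interval, where [F] is known. *)
Lemma cdf_between_nodes k s : (k <= n.+1)%N ->
  node b k - 2 * b < s -> s < node b k ->
  F s = (\sum_(j < k) m j)%:E.
Proof.
elim: k s => [|k IH] s kn s1 s2.
  rewrite big_ord0; apply: (probability_outside P01) => //.
  rewrite -subset0 => x [] /=; rewrite !in_itv /= => xs /andP[x0 _].
  by move: s2; rewrite node0; lra.
have {}IH u := IH u (ltnW kn).
move: s1 s2; rewrite nodeS addrK => s1 s2.
have good t : node b k < t -> t < node b k + 2 * b ->
    window_mass b P (t - b) = step b n m (t - b) -> F t = (\sum_(j < k.+1) m j)%:E.
  move=> t1 t2; rewrite (@stepE _ b n m k)//; last first.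
    by rewrite /cell /= in_itv /=; apply/andP; split; lra.
  move=> q; have w : P `]t - 2 * b, t[%classic = (m k)%:E.
    by rewrite -q -window_massE subrK (_ : t - b - b = t - 2 * b)//; lra.
  rewrite (@FD (t - 2 * b)); last lra.
  rewrite (IH (t - 2 * b)); [|lra|lra].
  rewrite big_ord_recr EFinD; congr (_ + _)%E.
  rewrite -w (@itv_bndbnd_setU _ _ _ (BRight (t - 2 * b)))//; try by rewrite bnd_simp; lra.
  rewrite measureU//; last first.
    rewrite -subset0 => x [] /=; rewrite !in_itv /= => /andP[_ xs] /andP[sx _].
    by move: (le_lt_trans xs sx); rewrite ltxx.
  (* The open window misses its left end [t - 2 * b]. That point has no mass, because [F] is
     constant from it to the midpoint [u] of the rest of the previous interval. *)
  rewrite [X in (X + _)%E](_ : _ = 0%E) ?add0e//.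
  set u := (t - 2 * b + node b k) / 2.
  have u1 : t - 2 * b < u by rewrite /u; lra.
  have u2 : u < node b k by rewrite /u; lra.
  have := FD (ltW u1); rewrite (IH u); [|lra|lra]; rewrite (IH (t - 2 * b)); [|lra|lra].
  set M := \sum_(j < k) m j => E.
  have z : P `[t - 2 * b, u[%classic = 0%E.
    have := congr1 (fun z => z - M%:E)%E E.
    by rewrite subee// addeAC subee// add0e => <-.
  apply/eqP; rewrite eq_le measure_ge0 andbT -z; apply: le_measure; rewrite ?inE//.
  move=> x /=; rewrite !in_itv /= => /andP[x1 x2]; rewrite x1 /=.
  exact: le_lt_trans x2 u1.
(* The window mass is known only almost everywhere, so [s] is squeezed between two good points and
   monotonicity of [F] concludes. *)
have [y1 /andP[y11 y12] q1] : exists2 y, node b k - b < y < s - b &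
    window_mass b P y = step b n m y.
  by apply: (ae_exists_itv qm); lra.
have [y2 /andP[y21 y22] q2] : exists2 y, s - b < y < node b k + b &
    window_mass b P y = step b n m y.
  by apply: (ae_exists_itv qm); lra.
have F1 := good (y1 + b); have F2 := good (y2 + b).
rewrite !addrK in F1 F2.
apply/eqP; rewrite eq_le -{1}F2; [|lra|lra|done]; rewrite -F1; [|lra|lra|done].
by apply/andP; split; apply: le_F; lra.
Qed.

(** Intervals shrinking to the node all have mass [m k], the jump of [F] there; continuity from
    above passes this to the intersection. *)
Lemma atom_mass k : (k <= n)%N -> P [set node b k] = (m k)%:E.
Proof.
(* The shift by two keeps [e i] below [2 * b], so both ends of [G i] stay strictly between the node
   and its neighbours. *)
move=> kn; pose e i : R := 2 * b * i.+2%:R^-1.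
have e0 i : 0 < e i by rewrite /e mulr_gt0 ?mulr_gt0// invr_gt0.
have e1 i : e i < 2 * b.
  by rewrite /e gtr_pMr ?mulr_gt0// invf_lt1// ltr1n.
pose G i : set R := `[node b k - e i, node b k + e i[%classic.
have GE : \bigcap_i G i = [set node b k].
  apply/seteqP; split => [x Gx|x /= -> i _]; last first.
    by rewrite /G /= in_itv /=; have := e0 i; move=> ?; apply/andP; split; lra.
  apply/eqP; apply/negPn/negP => xk.
  have d0 : 0 < `|x - node b k| / (2 * b).
    by rewrite divr_gt0 ?normr_gt0 ?subr_eq0 ?mulr_gt0.
  have [i] := ltr_add_invr d0; rewrite add0r ltr_pdivlMr ?mulr_gt0// => ie.
  have : G i x by exact: Gx.
  rewrite /G /= in_itv /= => /andP[x1 x2].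
  have : e i < `|x - node b k|.
    apply: le_lt_trans ie; rewrite /e mulrC ler_pM2r ?mulr_gt0//.
    by rewrite lef_pV2 ?posrE// ler_nat.
  rewrite ltNge ler_norml => /negP; apply; apply/andP; split; lra.
have PG i : P (G i) = (m k)%:E.
  have e0i := e0 i; have e1i := e1 i.
  have := @FD (node b k - e i) (node b k + e i); rewrite -/(G i).
  rewrite (@cdf_between_nodes k.+1)//; [|rewrite nodeS; lra|rewrite nodeS; lra].
  rewrite (@cdf_between_nodes k) ?(leqW kn)//; [|lra|lra].
  rewrite big_ord_recr EFinD /=; set M := \sum_(j < k) m j => /(_ _) E.
  have {}E := E ltac:(lra).
  have := congr1 (fun z => z - M%:E)%E E.
  by rewrite addeAC subee// add0e addeAC subee// add0e.
have : (P \o G) x @[x --> \oo] --> P (\bigcap_i G i).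
  apply: nonincreasing_cvg_mu => //.
  - by rewrite [X in (X < _)%E]PG ltry.
  - by move=> i; exact: measurable_itv.
  - by apply: bigcapT_measurable => i; exact: measurable_itv.
  - move=> i j ij; apply/subsetPset => x; rewrite /G /= !in_itv /= => /andP[x1 x2].
    have : e j <= e i.
      by rewrite /e ler_pM2l ?mulr_gt0// lef_pV2 ?posrE// ler_nat.
    by move=> ?; apply/andP; split; lra.
rewrite GE (_ : P \o G = cst (m k)%:E); last by apply/funext => i /=; rewrite PG.
by move=> /cvg_lim <-//; rewrite lim_cst.
Qed.

Lemma probability_from_window_mass A : measurable A ->
  P A = (\sum_(k < n.+1) m k * \1_A (node b k))%:E.
Proof.
apply: probability_of_atoms => // [j k|k kn].
- have w0 : 2 * b != 0 by rewrite gt_eqF// mulr_gt0.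
  by move=> /(mulIf w0)/eqP; rewrite eqr_nat => /eqP.
- by rewrite atom_mass.
Qed.
End uniqueness.

(** * The multiplier *)

Section gibbs. Context {R : realType} (n : nat) (alpha : R).
Hypothesis al0 : 0 < alpha.

Local Notation c j := (cost alpha (@std_pt R n j)).

Let c0 j : 0 <= c j. Proof. exact: powR_ge0. Qed.

(** The point [0] costs nothing as [alpha > 0], so its term alone is [1]. *)
Lemma gibbs_z_ge1 lam : 1 <= gibbs_z n alpha lam.
Proof.
rewrite /gibbs_z (bigD1 ord0)//= {1}/std_pt mul0r /cost powR0 ?gt_eqF//.
by rewrite mulr0 oppr0 expR0 lerDl sumr_ge0// => j _; exact: expR_ge0.
Qed.

Let mean lam := \sum_(j < n.+1) gibbs_mass n alpha lam j * c j.

Lemma mean_cost0 : mean 0 = crit_cost n alpha.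
Proof.
apply: eq_bigr => j _; congr (_ * _); rewrite /gibbs_mass /gibbs_z mul0r oppr0 expR0.
congr (_ / _); rewrite (eq_bigr (fun=> 1)); last by move=> i _; rewrite mul0r oppr0 expR0.
by rewrite sumr_const card_ord.
Qed.

(** Each term is at most [1 / lam], since [s * expR (- s) <= 1] at [s = lam * c j] and the
    normalisation is at least [1]. This brings the mean cost below any positive level. *)
Lemma mean_cost_le lam : 0 < lam -> mean lam <= n.+1%:R / lam.
Proof.
move=> l0; rewrite -[n.+1]card_ord mulr_natl -sumr_const; apply: ler_sum => j _.
have z1 := gibbs_z_ge1 lam; have z0 := lt_le_trans ltr01 z1.
apply: (@le_trans _ _ (expR (- (lam * c j)) * c j)).
  by rewrite ler_wpM2r// ler_pdivrMr// ler_peMr// expR_ge0.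
rewrite -(ler_pM2l l0) divff ?gt_eqF// mulrCA expRN ler_pdivrMl ?expR_gt0// mulr1.
by have := expR_ge1Dx (lam * c j); lra.
Qed.

Lemma continuous_mean_cost : continuous mean.
Proof.
move=> x.
have cexp j : (fun lam => expR (- (lam * c j))) @ x --> expR (- (x * c j)).
  apply: continuous_cvg; first exact: continuous_expR.
  by apply: cvgN; apply: cvgM; [exact: cvg_id|exact: cvg_cst].
apply: cvg_big => [|j _]; first exact: add_continuous.
apply: cvgM; last exact: cvg_cst.
apply: cvgM; first exact: cexp.
apply: cvgV; first by rewrite gt_eqF// (lt_le_trans _ (gibbs_z_ge1 x)).
apply: cvg_big => [|i _]; first exact: add_continuous.
exact: cexp.
Qed.

Lemma gibbs_multiplier_exists cbar : 0 < cbar -> cbar < crit_cost n alpha ->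
  exists2 lam, 0 < lam & mean lam = cbar.
Proof.
move=> cb0; rewrite -mean_cost0 => cb.
(* At [L] the bound of [mean_cost_le] is exactly [cbar], while at [0] the mean is the critical cost;
   the intermediate value theorem applies between them. *)
set L := n.+1%:R / cbar; have L0 : 0 < L by rewrite divr_gt0.
have mL : mean L <= cbar.
  by apply: le_trans (mean_cost_le L0) _; rewrite /L invf_div mulrC divfK.
have [|lam /[!in_itv]/= /andP[l0 _] E] :=
  IVT (ltW L0) (continuous_subspaceT continuous_mean_cost) (v := cbar).
  by rewrite ge_min mL orbT le_max (ltW cb).
exists lam => //; rewrite lt_neqAle l0 andbT; apply/eqP => l00.
by move: cb; rewrite l00 E ltxx.
Qed.
End gibbs.

(** * The Gibbs distribution *)

Section discrete_information.
Context {R : realType} (b : R) (n : nat) (P : probability R R) (m : nat -> R).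
Hypotheses (b0 : 0 < b) (m0 : forall k, 0 < m k).
Hypothesis PE : forall A : set R, P A = (\sum_(k < n.+1) m k * \1_A (node b k))%:E.

(** A node lies in the window around [y] exactly when [y] lies in the interior of its cell, and
    distinct cells are disjoint. *)
Lemma discrete_window_mass k y : (k <= n)%N -> node b k - b < y < node b k + b ->
  window_mass b P y = m k.
Proof.
move=> kn /andP[k1 k2]; rewrite /window_mass PE /= -[RHS](@stepE _ b n m k y b0 kn).
  apply: eq_bigr => j _; rewrite !indicE /cell; congr (_ * _%:R); congr nat_of_bool.
  rewrite mem_oo mem_setE in_itv /=; apply/idP/idP => /andP[j1 j2].
    by apply/andP; split; lra.
  have jk : nat_of_ord j = k.
    by apply: (@cell_inj _ b j k y b0);
      rewrite /cell /= in_itv /=; apply/andP; split; lra.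
  by rewrite jk; apply/andP; split; lra.
by rewrite /cell /= in_itv /=; apply/andP; split; lra.
Qed.

(** The noise window of a node is the interior of its cell, on which the output density is
    constant. *)
Lemma discrete_info_dens k : (k <= n)%N -> info_dens b P (node b k) = (- ln (m k))%:E.
Proof.
move=> kn; have r0 := noise_r_gt0 b0; rewrite /info_dens.
rewrite (@eq_integral _ _ _ _ _ (cst (noise_r b * - ln (m k))%:E)).
  rewrite integral_cst//= lebesgue_measure_itv /= lte_fin ltrD2l gtrN//.
  rewrite -EFinB -EFinM /noise_r; congr _%:E; field.
  by rewrite gt_eqF.
move=> y; rewrite mem_oo => yk.
have q0 : window_mass b P y != 0 by rewrite (discrete_window_mass kn yk) gt_eqF.
have /negbTE -> : out_dens b P y != 0.
  by rewrite /out_dens -/(window_mass b P y) mulf_neq0// gt_eqF.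
by rewrite ln_out_densE// (discrete_window_mass kn yk).
Qed.
End discrete_information.

Theorem mainTheorem1 (R : realType) (b : R) (n : nat) (alpha cbar : R) :
  0 < b -> noise_r b = n%:R ->
  0 < alpha -> alpha <= 1 ->
  0 < cbar -> cbar < crit_cost n alpha ->
  exists lam : R,
    0 < lam /\
    \sum_(j < n.+1) gibbs_mass n alpha lam j * cost alpha (std_pt n j) = cbar /\
    (exists P : probability R R, capacity_achieving b alpha cbar P) /\
    (forall P : probability R R, capacity_achieving b alpha cbar P ->
       forall A : set R, measurable A -> P A = gibbs_distr n alpha lam A).
Proof.
move=> b0 nE al0 al1 cb0 cb.
have [lam lam0 meanE] := gibbs_multiplier_exists al0 cb0 cb.
exists lam; do 2 split=> //.
have nb : n%:R * (2 * b) = 1 by rewrite -nE /noise_r divfK// gt_eqF// mulr_gt0.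
have n_neq0 : n%:R != 0 :> R.
  by apply/eqP => n0; move: nb; rewrite n0 mul0r => /esym/eqP; rewrite oner_eq0.
have ptE (j : 'I_n.+1) : std_pt n j = node b j.
  apply: (mulIf n_neq0).
  by rewrite /std_pt /node divfK// -mulrA (mulrC (2 * b)) nb mulr1.
set Z := gibbs_z n alpha lam; have Z1 : 1 <= Z := gibbs_z_ge1 n al0 lam.
have Z0 : 0 < Z := lt_le_trans ltr01 Z1.
pose m (k : nat) : R := expR (- (lam * cost alpha (node b k))) / Z.
have mE (j : 'I_n.+1) : gibbs_mass n alpha lam j = m j by rewrite /gibbs_mass ptE.
have m0 k : 0 < m k by rewrite divr_gt0// expR_gt0.
have m1 : \sum_(k < n.+1) m k = 1.
  rewrite -mulr_suml -[X in X / _](_ : Z = _) ?divff ?gt_eqF//.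
  by apply: eq_bigr => j _; rewrite ptE.
have lmE k : - ln (m k) = lam * cost alpha (node b k) + ln Z.
  by rewrite /m ln_div ?posrE ?expR_gt0// expRK; ring.
have lZ0 : 0 <= ln Z by rewrite ln_ge0.
have distrE A : gibbs_distr n alpha lam A = (\sum_(k < n.+1) m k * \1_A (node b k))%:E.
  by congr _%:E; apply: eq_bigr => j _; rewrite mE ptE.
have costE : \sum_(k < n.+1) m k * cost alpha (node b k) = cbar.
  by rewrite -meanE; apply: eq_bigr => j _; rewrite mE ptE.
have m0n k : (k <= n)%N -> 0 < m k by [].
have cross_le Q : feasible alpha cbar Q ->
    (\int[lebesgue_measure]_y (noise_r b * (window_mass b Q y *
       step b n (fun k => - ln (m k)) y))%:E <= (lam * cbar + ln Z)%:E)%E.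
  move=> [Q01 Qc]; exact: (cross_entropy_le b0 nb Q01 m0n m1 al0 al1
    (ltW lam0) lZ0 (fun k _ => lmE k) Qc).
have info_le Q : feasible alpha cbar Q ->
    (mutual_info b Q <= (lam * cbar + ln Z)%:E)%E.
  move=> Qf; apply: le_trans (cross_le Q Qf).
  exact: (mutual_info_le_cross_entropy b0 nb Qf.1 m0n m1).
have [P [PE Pint]] :=
  discrete_probability_exists (node b) (fun k => ltW (m0 k)) m1.
have nd01 (k : 'I_n.+1) : 0 <= node b k <= 1.
  by rewrite -{1}(node0 b) -nb !le_node// -ltnS.
have Pfeas : feasible alpha cbar P.
  split.
    rewrite /admissible PE; congr _%:E; rewrite -[RHS]m1; apply: eq_bigr => k _.
    by rewrite indicE mem_set ?mulr1//= in_itv /=; exact: nd01.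
  rewrite Pint//; last 2 first.
  - by apply: measurable_funTS; apply/measurable_EFinP; exact: measurable_powR.
  - by move=> x _; rewrite lee_fin powR_ge0.
  rewrite -costE -sumEFin; apply: lee_sum => k _.
  by rewrite diracE mem_set ?mul1e//= in_itv /=; exact: nd01.
have Pinfo : mutual_info b P = (lam * cbar + ln Z)%:E.
  rewrite /mutual_info Pint//; last 2 first.
  - exact: measurable_info_dens.
  - by move=> x _; exact: info_dens_ge0.
  (* [ln Z] is spread over the masses, which sum to [1], to compare term by term. *)
  rewrite -costE mulr_sumr -[ln Z]mulr1 -m1 mulr_sumr -big_split/= -sumEFin.
  apply: eq_bigr => k _; rewrite diracT mul1e (discrete_info_dens b0 m0 PE) -1?ltnS//.
  by rewrite lmE -EFinM; congr _%:E; ring.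
split; first by exists P; split=> // Q Qf; rewrite Pinfo; exact: info_le.
move=> Q [Qf Qmax] A mA; rewrite distrE.
(* Being maximal, [Q] does at least as well as the feasible Gibbs distribution [P], which attains
   the bound. *)
have QV : mutual_info b Q = (lam * cbar + ln Z)%:E.
  by apply/eqP; rewrite eq_le info_le//= -Pinfo Qmax.
have Q01 := Qf.1.
apply: (probability_from_window_mass b0 Q01 m1 _ mA).
(* The cross entropy of [Q] lies between its information and the same bound, so all three agree. *)
apply: (mutual_info_eq_cross_entropy b0 nb Q01 m0n m1); last by rewrite QV.
apply/eqP; rewrite eq_le mutual_info_le_cross_entropy// QV.
exact: cross_le.
Qed.
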